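(* If $G$ is a BK-free line graph (of a multigraph) with $\omega(G)<\Delta(G)$, then $\Delta(G)<69$. Consequently, if $G$ is a line graph with $\Delta(G)\ge 69$, then $\chi_{OL}(G)\le\max\{\omega(G),\Delta(G)-1\}$.
   Context: The line graph of a loopless multigraph $H$ has vertex set $E(H)$, two vertices adjacent when the corresponding edges share an endpoint. For $f:V(G)\to\mathbb{Z}^+$, $G$ is $f$-paintable if Painter has a winning strategy in the game where each vertex $v$ starts with $f(v)$ tokens; each round Lister chooses a nonempty set $M$ of uncolored vertices and removes one token from each, then Painter colors (removes) an independent set $I\subseteq M$; Lister wins if some uncolored vertex runs out of tokens, Painter wins if all vertices get colored. $\chi_{OL}(G)$ is the least $k$ with $G$ $f$-paintable for $f\equiv k$. For a graph $G$ and $f:V(G)\to\mathbb{Z}^+$, an orientation $D$ of $E(G)$ is an Alon--Tarsi orientation for $f$ if $d^+_D(v)<f(v)$ for every vertex $v$ and the number of spanning Eulerian subgraphs of $D$ (spanning subdigraphs in which every vertex has equal in- and out-degree) with an even number of edges differs from the number with an odd number of edges; $G$ is $f$-AT if such an orientation exists. A digraph (in which some edges may be oriented in both directions) is kernel-perfect if every induced subdigraph $D'$ has a kernel, i.e., a set $I\subseteq V(D')$ with no arc between two of its vertices such that every vertex of $D'$ not in $I$ has an out-neighbor in $I$. A graph $H$ is $f$-KP if some supergraph $H'$ of $H$ on the same vertex set (possibly with parallel edges) has a kernel-perfect orientation with $d^+(v)<f(v)$ for all $v$. A connected graph $G$ is BK-free if it has no induced subgraph $H$ that is $f_H$-AT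 or $f_H$-KP, where $f_H(v)=d_H(v)-1+\Delta(G)-d_G(v)$ for $v\in V(H)$. *)

(* Defs.v *)
From mathcomp Require Import all_boot.
Set Implicit Arguments. Unset Strict Implicit. Unset Printing Implicit Defensive.

Section Defs.
Variable T : finType.
Implicit Types (e : rel T) (S U M I W K : {set T}) (f : T -> nat).

Definition simple_graph e := symmetric e /\ irreflexive e.

(* G is the line graph of a loopless multigraph H: the edges of H are indexed
   by the vertices of G, [ends x] gives the two (distinct) endpoints of edge x,
   and two distinct vertices of G are adjacent iff the edges share an endpoint. *)
Definition is_line_graph e :=
  exists (V : finType) (ends : T -> V * V),
    (forall x, (ends x).1 != (ends x).2) /\
    (forall x y, x != y ->
       e x y = [|| (ends x).1 == (ends y).1, (ends x).1 == (ends y).2,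
                   (ends x).2 == (ends y).1 | (ends x).2 == (ends y).2]).

Definition connected e := forall x y, connect e x y.

Definition deg e S v := #|[set u in S | e v u]|.
Definition degG e v := deg e setT v.
Definition Delta e := \max_(v : T) degG e v.

Definition clique e S := [forall x in S, forall y in S, (x != y) ==> e x y].
Definition omega e := \max_(S : {set T} | clique e S) #|S|.

Definition independent e I := [forall x in I, forall y in I, ~~ e x y].

(* paintable e U f : Painter wins from the position where U is the set of
   uncoloured vertices and f gives their current numbers of tokens. *)
Inductive paintable e : {set T} -> (T -> nat) -> Prop :=
| Paint U f :
    (forall v, v \in U -> 0 < f v) ->
    (forall M, M \subset U -> M != set0 ->
       exists I, [/\ I \subset M, independent e I &
         paintable e (U :\: I) (fun v => if v \in M then (f v).-1 else f v)]) ->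
    paintable e U f.

Definition f_paintable e f := paintable e setT f.

Definition chiOL_le e m := exists k, 0 < k <= m /\ f_paintable e (fun _ => k).

Definition orientation_of e S (D : rel T) :=
  (forall u v, D u v -> [&& u \in S, v \in S & e u v]) /\
  (forall u v, u \in S -> v \in S -> e u v -> D u v (+) D v u).

Definition outdeg (D : rel T) v := #|[set u | D v u]|.

Definition eulerian_sub (D : rel T) (A : {set T * T}) :=
  (A \subset [set p | D p.1 p.2]) &&
  [forall v, #|[set p in A | p.1 == v]| == #|[set p in A | p.2 == v]|].

Definition AT_orientation e S f (D : rel T) :=
  [/\ orientation_of e S D,
      (forall v, v \in S -> outdeg D v < f v) &
      #|[set A : {set T * T} | eulerian_sub D A && ~~ odd #|A| ]|
      <> #|[set A : {set T * T} | eulerian_sub D A && odd #|A| ]| ].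

Definition f_AT e S f := exists D, AT_orientation e S f D.

Definition kernel_perfect (r : rel T) S :=
  forall W, W \subset S ->
    exists K, [/\ K \subset W,
      (forall x y, x \in K -> y \in K -> ~~ r x y) &
      (forall x, x \in W -> x \notin K -> exists2 y, y \in K & r x y)].

(* a u v = number of arcs u -> v in an orientation of a loopless multigraph
   H' on S containing all edges of G[S] (edge multiplicity a u v + a v u). *)
Definition f_KP e S f :=
  exists a : T -> T -> nat,
    [/\ (forall u v, 0 < a u v -> [&& u \in S, v \in S & u != v]),
        (forall u v, u \in S -> v \in S -> e u v -> 0 < a u v + a v u),
        (forall v, v \in S -> \sum_(u : T) a v u < f v) &
        kernel_perfect (fun u v => 0 < a u v) S].

(* f_H(v) = d_H(v) - 1 + Delta(G) - d_G(v); a value of -1 is represented by 0,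
   which is harmless since f only occurs in strict upper bounds d^+(v) < f(v). *)
Definition fH e S v := (deg e S v + (Delta e - degG e v)).-1.

Definition BK_free e :=
  connected e /\
  forall S : {set T}, S != set0 -> ~ f_AT e S (fH e S) /\ ~ f_KP e S (fH e S).

End Defs.

(* Main.v *)
Require Import Defs.
From mathcomp Require Import all_boot zify.
Set Implicit Arguments. Unset Strict Implicit. Unset Printing Implicit Defensive.

(** Kernel-perfect orientations suffice; no Alon-Tarsi orientation is needed.
    Both parts follow from one statement: if D >= 69 and the line graph G of H
    has all degrees at most D and all cliques smaller than D, then some induced
    subgraph S has a kernel-perfect orientation with outdegrees below
    d_S - 1 + D - d_G.  The first part is the case D = Delta(G).  For the
    second, take D = k + 1 with k = max(omega, Delta - 1) and paint an induced
    subgraph inductively, S after the rest; this covers Brooks' theorem for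
    Delta-regular pieces too.

    The outdegree bound says that every v in S has at least d_G(v) + 2 - D
    neighbours to which it sends no arc.  A vertex of degree at most D - 2 is
    such an S by itself.  Four parallel edges xy together with nonadjacent edges
    at x and at y give an S on 6 or 8 vertices, which exist because the edges
    at x or y form no clique of size D.  So multiplicities are at most 3, and then
    we look for a bipartite subgraph of H with an assignment of its (simple) edges
    to their endpoints in which every vertex owns two edges, or one if it has only
    two neighbours.  Each endpoint ranks the edges it owns lowest, and Galvin's
    stable matching argument provides the kernels.  By Hall's theorem the
    assignment exists inside any bipartite subgraph that has at least as many edges
    as the total demand.  With X the vertices of degree at most 34 and Y the
    others, adjacent vertices of H have degree sum at least 70, so X is independent,
    and weighted counting shows that either the X-Y edges are dense enough, or so is
    a cut containing at least half of the edges inside Y. *)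

(** * The painting game *)

Lemma paintable_ext (T : finType) (e : rel T) (U : {set T}) (f g : T -> nat) :
  {in U, f =1 g} -> paintable e U f -> paintable e U g.
Proof.
(* The recursive occurrence of [paintable] lies under an existential, hence the explicit guarded
   fixpoint. *)
move=> eqfg H; move: U f H g eqfg; fix IH 3 => U f [{}U {}f fpos Hwin] g eqfg.
constructor=> [v vU|M sMU M0]; first by rewrite -eqfg ?fpos.
destruct (Hwin M sMU M0) as [I [sIM indI HI]].
exists I; split=> //; apply: (IH _ _ HI) => v; rewrite inE => /andP[_ vU].
by rewrite eqfg.
Qed.

(* Painter answers on [R] with the given strategy, and on [S'] with a kernel of
   the marked vertices not yet blocked by that answer: a marked vertex of [S']
   that stays uncoloured loses a neighbour in [R] or an out-neighbour in [S']. *)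
Lemma paintable_kernel_extend (T : finType) (e r : rel T) (S : {set T}) :
    symmetric e -> irreflexive e -> kernel_perfect r S ->
    (forall u v, u \in S -> v \in S -> e u v -> r u v || r v u) ->
  forall (R S' : {set T}) f, S' \subset S -> [disjoint R & S'] ->
    paintable e R f ->
    (forall v, v \in S' -> #|[set u in S' | r v u]| + deg e R v < f v) ->
  paintable e (R :|: S') f.
Proof.
move=> esym eirr kp er R S' f.
(* Induction on the total number of tokens, which drops in every round since [M] is nonempty. *)
have [n le_n] := ubnP (\sum_(v in R :|: S') f v).
elim: n R S' f le_n => // n IHn R S' f le_n sS'S dRS' pR fS'.
have fposR v : v \in R -> 0 < f v by case: pR v => U g gpos _ v /gpos.
have fpos v : v \in R :|: S' -> 0 < f v.
  by case/setUP=> [/fposR //|/fS']; apply: leq_ltn_trans.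
constructor=> // M sM M0.
pose f' := fun v => if v \in M then (f v).-1 else f v.
(* If [M] misses [R], the strategy on [R] has no round to answer, but no token on [R] is spent
   either, so the empty answer works. *)
have [I [sIM indI pI]] : exists I : {set T},
    [/\ I \subset M :&: R, independent e I & paintable e (R :\: I) f'].
  have [MR0|MR0] := eqVneq (M :&: R) set0.
    exists set0; split; first exact: sub0set.
      by apply/forall_inP => x; rewrite inE.
    rewrite setD0; apply: paintable_ext pR => v vR; rewrite /f'.
    by case: ifP => // vM; move/setP/(_ v): MR0; rewrite !inE vM vR.
  case: pR MR0 {fS' dRS' le_n fposR fpos sM} @f' => U g _ Hwin MR0 f'.
  have [I [sI indI pI]] := Hwin _ (subsetIr M U) MR0.
  exists I; split=> //; apply: paintable_ext pI => v.
  by rewrite !inE /f' => /andP[_ ->]; rewrite andbT.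
pose M' := [set v in M :&: S' | [forall u in I, ~~ e v u]].
have sM'S' : M' \subset S' by apply/subsetP=> v; rewrite !inE => /andP[/andP[]].
have [K [sKM' indK absK]] := kp M' (subset_trans sM'S' sS'S).
have sKM : {subset K <= M} by move=> v /(subsetP sKM'); rewrite !inE => /andP[/andP[]].
have sKS' : {subset K <= S'} by move=> v /(subsetP sKM')/(subsetP sM'S').
have sIM1 : {subset I <= M} by move=> v /(subsetP sIM); rewrite !inE => /andP[].
have sIR : {subset I <= R} by move=> v /(subsetP sIM); rewrite !inE => /andP[].
have KI u v : u \in K -> v \in I -> ~~ e u v.
  move=> /(subsetP sKM'); rewrite !inE => /andP[_ /forall_inP h] /h //.
have disj v : v \in R -> v \in S' -> False.
  by move=> vR vS; move/pred0P/(_ v): dRS'; rewrite /= vR vS.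
exists (I :|: K); split.
- by apply/subsetP => v /setUP[/sIM1|/sKM].
- apply/forall_inP => u /setUP uIK; apply/forall_inP => v /setUP vIK.
  case: uIK => [uI|uK]; case: vIK => [vI|vK].
  + exact: (forall_inP (forall_inP indI u uI) v vI).
  + by rewrite esym KI.
  + exact: KI.
  + apply/negP => euv.
    have := er _ _ (subsetP sS'S _ (sKS' _ uK)) (subsetP sS'S _ (sKS' _ vK)) euv.
    by rewrite (negbTE (indK _ _ uK vK)) (negbTE (indK _ _ vK uK)).
have -> : (R :|: S') :\: (I :|: K) = (R :\: I) :|: (S' :\: K).
  apply/setP => v; rewrite !inE.
  have [vR|vR] := boolP (v \in R); have [vS|vS] := boolP (v \in S') => /=.
  - by case: (disj v).
  - by rewrite (contraNF (@sKS' v) vS) !orbF ?andbF ?andbT ?orbF ?andTb.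
  - by rewrite (contraNF (@sIR v) vR) ?andbF ?andbT ?orbF ?andTb.
  - by rewrite ?andbF.
apply: IHn => //.
- rewrite -ltnS; apply: leq_trans le_n; rewrite ltnS.
  have [v0 v0M] := set0Pn _ M0.
  have v0U := subsetP sM _ v0M.
  apply: (@leq_trans (\sum_(v in R :|: S') f' v).+1).
    rewrite ltnS [X in _ <= X](big_setID (R :\: I :|: S' :\: K)) /=.
    by rewrite (setIidPr _) ?leq_addr // setUSS ?subsetDl.
  rewrite (bigD1 v0) //= [X in _ <= X](bigD1 v0) //= /f' v0M.
  rewrite -addSn prednK ?fpos // leq_add2l; apply: leq_sum => v _.
  by case: ifP; rewrite ?leq_pred.
- by apply: subset_trans sS'S; apply: subsetDl.
- by apply: disjointW dRS'; apply: subsetDl.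
move=> v; rewrite inE => /andP[vK vS].
have le1 : #|[set u in S' :\: K | r v u]| <= #|[set u in S' | r v u]|.
  by apply/subset_leq_card/subsetP => u; rewrite !inE => /andP[/andP[_ ->]].
have le2 : deg e (R :\: I) v <= deg e R v.
  by apply/subset_leq_card/subsetP => u; rewrite !inE => /andP[/andP[_ ->]].
have := fS' v vS; rewrite /f'; case: ifP => vM; last by lia.
suff : (#|[set u in S' :\: K | r v u]| < #|[set u in S' | r v u]|) ||
       (deg e (R :\: I) v < deg e R v) by lia.
have [vM'|vM'] := boolP (v \in M').
  have [y yK ryv] := absK v vM' vK.
  apply/orP; left; apply: proper_card; apply/properP; split.
    by apply/subsetP => u; rewrite !inE => /andP[/andP[_ ->]].
  by exists y; rewrite !inE ?sKS' ?yK.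
move: vM'; rewrite !inE vM vS /= negb_forall_in => /exists_inP[u uI]; rewrite negbK => evu.
apply/orP; right; apply: proper_card; apply/properP; split.
  by apply/subsetP => w; rewrite !inE => /andP[/andP[_ ->]].
by exists u; rewrite !inE ?sIR ?uI.
Qed.

(** * Hall's theorem, cuts and stable matchings *)

Lemma hall_orientation (I V : finType) (al : I -> {set V}) (dem : V -> nat) :
    (forall U : {set V}, \sum_(v in U) dem v <= #|[set p | ~~ [disjoint al p & U]]|) ->
  exists o : I -> {set V},
    [/\ forall p, o p \subset al p, forall p, #|o p| <= 1
      & forall v, dem v <= #|[set p | v \in o p]|].
Proof.
(* While some [al p] contains [x != y], one of them can be deleted: otherwise
   there are tight sets [U1], [U2] on which the deletions fail, and counting [p]
   contradicts submodularity. *)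
have [n le_n] := ubnP (\sum_p #|al p|).
elim: n al le_n => // n IHn al le_n hall.
have [/forallP al1|] := boolP [forall p, #|al p| <= 1].
  exists al; split=> // v.
  have := hall [set v]; rewrite big_set1 => /leq_trans; apply.
  apply/subset_leq_card/subsetP => p; rewrite !inE => /pred0Pn[w /=].
  by rewrite inE => /andP[wp /eqP <-].
rewrite negb_forall => /existsP[p0]; rewrite -ltnNge => /card_gt1P[x [y [xp yp xy]]].
pose M (a : I -> {set V}) (U : {set V}) := [set p | ~~ [disjoint a p & U]].
pose ald z p := if p == p0 then al p0 :\ z else al p.
have reduce z : z \in al p0 ->
    (forall U : {set V}, \sum_(v in U) dem v <= #|M (ald z) U|) ->
    exists o : I -> {set V},
    [/\ forall p, o p \subset al p, forall p, #|o p| <= 1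
      & forall v, dem v <= #|[set p | v \in o p]|].
  move=> zp hallz.
  have sub p : ald z p \subset al p.
    by rewrite /ald; case: eqP => [->|_]; rewrite ?subD1set.
  case: (IHn (ald z)) => //.
    rewrite -ltnS; apply: leq_trans le_n; rewrite ltnS.
    rewrite (bigD1 p0) //= [X in _ < X](bigD1 p0) //= -addSn leq_add //.
      by rewrite /ald eqxx [X in _ < X](cardsD1 z) zp.
    by apply: leq_sum => p _; apply: subset_leq_card.
  move=> o [os o1 od]; exists o; split=> // p; exact: subset_trans (os p) (sub p).
have tight z U : z \in al p0 -> #|M (ald z) U| < \sum_(v in U) dem v ->
    [/\ p0 \in M al U, #|M al U| = \sum_(v in U) dem v & forall w, w \in al p0 -> w \in U -> w = z].
  move=> zp viol.
  have sub : M al U \subset p0 |: M (ald z) U.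
    apply/subsetP => p; rewrite !inE /ald; case: eqP => //.
  have := subset_leq_card sub; rewrite cardsU1 => c1.
  have := hall U; rewrite -/(M al U) => c2.
  have p0M : p0 \notin M (ald z) U by case: (p0 \in _) c1 => /=; lia.
  have uniqz w : w \in al p0 -> w \in U -> w = z.
    move=> wp wU; apply/eqP; apply: contraNT p0M => wz; rewrite inE.
    by apply/pred0Pn; exists w; rewrite /= /ald eqxx !inE wz wp.
  split=> //; last by move: c1; rewrite p0M /=; lia.
  apply: contraTT isT => p0nM.
  suff : #|M al U| <= #|M (ald z) U| by lia.
  apply/subset_leq_card/subsetP => p pM; have := subsetP sub p pM.
  by rewrite !inE => /orP[/eqP pp|//]; move: p0nM; rewrite -pp pM.
have [/forallP hx|] := boolP [forall U : {set V}, \sum_(v in U) dem v <= #|M (ald x) U|].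
  exact: reduce hx.
rewrite negb_forall => /existsP[U1]; rewrite -ltnNge => /(tight _ _ xp)[p1 t1 u1].
have [/forallP hy|] := boolP [forall U : {set V}, \sum_(v in U) dem v <= #|M (ald y) U|].
  exact: reduce hy.
rewrite negb_forall => /existsP[U2]; rewrite -ltnNge => /(tight _ _ yp)[p2 t2 u2].
have dU : \sum_(v in U1 :|: U2) dem v + \sum_(v in U1 :&: U2) dem v =
          \sum_(v in U1) dem v + \sum_(v in U2) dem v.
  rewrite [X in X + _](big_setID U1) /= setUK setDUl setDv set0U.
  by rewrite [X in _ = _ + X](big_setID U1) /= setIC; lia.
have h1 := hall (U1 :|: U2); have h2 := hall (U1 :&: U2).
have s1 : M al (U1 :|: U2) \subset M al U1 :|: M al U2.
  apply/subsetP => p; rewrite !inE => /pred0Pn[w /=]; rewrite inE.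
  case/andP=> wp /orP[wU|wU]; apply/orP; [left|right]; apply/pred0Pn;
    by exists w; rewrite /= wp wU.
(* [al p0] meets [U1] only in [x] and [U2] only in [y], so [p0] is lost on the intersection; this
   makes the submodular inequality strict. *)
have s2 : M al (U1 :&: U2) \subset (M al U1 :&: M al U2) :\ p0.
  apply/subsetP => p; rewrite !inE => /pred0Pn[w /=]; rewrite inE.
  case/and3P=> wp w1 w2; apply/and3P; split.
  - by apply: contraNneq xy => pp; rewrite pp in wp; rewrite -(u1 w) // -(u2 w).
  - by apply/pred0Pn; exists w; rewrite /= wp.
  - by apply/pred0Pn; exists w; rewrite /= wp.
have := subset_leq_card s1; have := subset_leq_card s2.
have := cardsUI (M al U1) (M al U2).
rewrite (cardsD1 p0 (_ :&: _)) inE p1 p2 /= t1 t2 -dU.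
by rewrite -/(M al _) in h1 *; move: h1 h2; rewrite -!/(M al _); lia.
Qed.

(** Greedy cut: each new vertex goes to the side where it has fewer neighbours. The factor is 4
    because the cut has at least half of the edges and the double sum over [Y] counts every edge
    twice. *)
Lemma half_cut (V : finType) (g : rel V) (Y : {set V}) :
    symmetric g -> irreflexive g ->
  exists2 P : {set V}, P \subset Y &
    \sum_(u in Y) \sum_(v in Y) g u v <= 4 * \sum_(u in P) \sum_(v in Y :\: P) g u v.
Proof.
move=> gsym girr; have [n le_n] := ubnP #|Y|.
elim: n Y le_n => // n IHn Y le_n.
have [->|/set0Pn[z zY]] := eqVneq Y set0.
  by exists set0; rewrite ?sub0set // big_set0.
have [|P sP IH] := IHn (Y :\ z).
  by rewrite -ltnS; apply: leq_trans le_n; rewrite ltnS [X in _ < X](cardsD1 z) zY.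
set Y' := Y :\ z in sP IH.
have zY' : z \notin Y' by rewrite !inE eqxx.
have zP : z \notin P by apply: contra zY' => /(subsetP sP).
have defY : Y = z |: Y' by rewrite setD1K.
have tot : \sum_(u in Y) \sum_(v in Y) g u v =
    2 * (\sum_(v in P) g z v + \sum_(v in Y' :\: P) g z v) +
    \sum_(u in Y') \sum_(v in Y') g u v.
  have dz : \sum_(v in Y') (g z v : nat) = \sum_(v in P) g z v + \sum_(v in Y' :\: P) g z v.
    by rewrite (big_setID P) /= (setIidPr sP).
  rewrite defY (big_setU1 _ zY') /= (big_setU1 _ zY') /= girr dz.
  under [X in _ + X]eq_bigr => u _ do rewrite (big_setU1 _ zY') /= gsym.
  by rewrite big_split /= dz; lia.
have [le|lt] := leqP (\sum_(v in P) g z v) (\sum_(v in Y' :\: P) g z v).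
  exists (z |: P).
    by rewrite defY; apply: setUS.
  have -> : Y :\: (z |: P) = Y' :\: P by rewrite /Y' setDDl.
  by rewrite tot (big_setU1 _ zP) /=; lia.
exists P; first by apply: subset_trans sP _; apply: subD1set.
have -> : Y :\: P = z |: (Y' :\: P).
  by rewrite defY setDUl; congr (_ :|: _); apply/setDidPl; rewrite disjoints1.
have zD : z \notin Y' :\: P by rewrite inE (negbTE zY') andbF.
rewrite tot; under [X in _ <= 4 * X]eq_bigr => u _ do rewrite (big_setU1 _ zD) /= gsym.
by rewrite big_split /=; lia.
Qed.

(* Galvin: if the favourites of the left endpoints do not form a matching, drop
   the less preferred of two favourites clashing on the right. *)
Lemma stable_kernel (T X Y : finType) (l : T -> X) (r : T -> Y) (kl kr : T -> nat) (S : {set T}) :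
    (forall t t', r t = r t' -> kr t = kr t' -> t = t') ->
  kernel_perfect (fun t t' => [&& t \in S, t' \in S &
     (l t == l t') && (kl t < kl t') || (r t == r t') && (kr t < kr t')]) S.
Proof.
move=> krI W; have [n le_n] := ubnP #|W|.
elim: n W le_n => // n IHn W le_n sWS.
pose top t := [forall t' in W, (l t' == l t) ==> (kl t' <= kl t)].
pose M := [set t in W | top t].
have sMW : M \subset W by apply/subsetP => t; rewrite inE => /andP[].
have topP t t' : t \in M -> t' \in W -> l t' = l t -> kl t' <= kl t.
  by rewrite inE => /andP[_ /forall_inP h] /h /implyP h' /eqP.
have [/exists_inP[t tM /exists_inP[t' t'M /and3P[tt' rtt' lt]]]|nclash] :=
  boolP [exists t in M, [exists t' in M, [&& t != t', r t == r t' & kr t' < kr t]]].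
  have tW := subsetP sMW t tM; have t'W := subsetP sMW t' t'M.
  have [||K [sK indK absK]] := IHn (W :\ t').
  - by rewrite -ltnS; apply: leq_trans le_n; rewrite ltnS [X in _ < X](cardsD1 t') t'W.
  - by apply: subset_trans sWS; apply: subD1set.
  have sKW : {subset K <= W} by move=> k /(subsetP sK)/setD1P[].
  exists K; split=> //; first by apply/subsetP.
  move=> x xW xK; have [xt'|xt'] := eqVneq x t'; last by apply: absK; rewrite // !inE xt'.
  rewrite {}xt' in xW xK *.
  (* Arcs lead to larger keys, so [t'] points to [t]. If [t] is not in [K], its out-neighbour in [K]
     cannot share the left endpoint, where [t] is a favourite; so it beats [t], hence also [t'], on
     the right. *)
  have [tK|tK] := boolP (t \in K).
    by exists t; rewrite // !(subsetP sWS) //= (eqP rtt') eqxx lt orbT.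
  have [|k kK /and3P[_ kS]] := absK t _ tK; first by rewrite !inE tt'.
  case/orP=> /andP[/eqP ek ltk].
    by have := topP t k tM (sKW _ kK) (esym ek); rewrite leqNgt ltk.
  exists k; rewrite // (subsetP sWS) // kS /= -ek (eqP rtt') eqxx /=.
  by rewrite (ltn_trans lt ltk) orbT.
exists M; split=> //.
  move=> t t' tM t'M; apply/negP => /and3P[_ _ /orP[|] /andP[/eqP et ltt]].
    by have := topP t t' tM (subsetP sMW _ t'M) (esym et); rewrite leqNgt ltt.
  move/negP: nclash; apply; apply/exists_inP; exists t' => //; apply/exists_inP; exists t => //.
  by rewrite et eqxx ltt !andbT; apply: contraTneq ltt => ->; rewrite ltnn.
move=> x xW xM.
have px : (x \in W) && (l x == l x) by rewrite xW eqxx.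
case: (@arg_maxnP _ x (fun y => (y \in W) && (l y == l x)) kl px) => y /andP[yW /eqP ly] ymax.
have yM : y \in M.
  rewrite inE yW; apply/forall_inP => z zW; apply/implyP => /eqP lz.
  by apply: ymax; rewrite zW lz ly eqxx.
exists y => //; rewrite !(subsetP sWS) //= ly eqxx /=; apply/orP; left.
move: xM; rewrite inE xW negb_forall_in => /exists_inP[z zW].
rewrite negb_imply -ltnNge => /andP[/eqP lz ltz].
by apply: leq_trans ltz _; apply: ymax; rewrite zW lz eqxx.
Qed.

(** * Explicit orientations around parallel edges *)

Fixpoint sublists (A : Type) (s : seq A) : seq (seq A) :=
  if s is x :: s' then sublists s' ++ map (cons x) (sublists s') else [:: [::]].

Lemma filter_sublists (A : eqType) (p : pred A) (s : seq A) : filter p s \in sublists s.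
Proof.
elim: s => //= x s IHs; rewrite mem_cat; case: (p x); last by rewrite IHs.
by rewrite map_f ?orbT.
Qed.

(* A pattern on the vertices 0, ..., n-1 lists for each i the neighbours that are
   worse than i: the arcs go from i to its other neighbours. *)
Definition pattern_arc (adj : rel nat) (worse : seq (seq nat)) : rel nat :=
  fun i j => adj i j && (j \notin nth [::] worse i).

(** A decidable check: the lists are consistent, and every vertex subset has a kernel. Only
    candidates with at most two vertices are tried, since the graphs used below have independence
    number 2. *)
Definition kernel_pattern (n : nat) (adj : rel nat) (worse : seq (seq nat)) :=
  let r := pattern_arc adj worse in
  let I := iota 0 n in
  let small := [::] :: [seq [:: i] | i <- I] ++ [seq [:: i; j] | i <- I, j <- I] in
  [&& all (fun i => let w := nth [::] worse i in
            uniq w && all (fun j => [&& j < n, adj i j & i \notin nth [::] worse j]) w) I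
    & all (fun m => has (fun k =>
        [&& all (mem m) k, all (fun i => all (fun j => ~~ r i j) k) k
          & all (fun i => (i \in k) || has (r i) k) m]) small) (sublists I)].

Lemma kernel_perfect_pattern (T : finType) (t0 : T) (s : seq T) adj worse :
    uniq s -> kernel_pattern (size s) adj worse ->
  kernel_perfect (fun x y => [&& x \in s, y \in s &
                    pattern_arc adj worse (index x s) (index y s)]) [set x in s].
Proof.
move=> us /andP[_ /allP kp] W sW.
pose m := [seq i <- iota 0 (size s) | nth t0 s i \in W].
have /hasP[k _ /and3P[/allP km /allP kind /allP kabs]] := kp m (filter_sublists _ _).
have kn i : i \in k -> (i < size s) && (nth t0 s i \in W).
  by move/km; rewrite /= mem_filter mem_iota /= add0n andbC.
exists [set x in map (nth t0 s) k].
have inK x : reflect (exists2 i, i \in k & x = nth t0 s i) (x \in [set x in map (nth t0 s) k]).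
  by rewrite inE; apply: mapP.
split.
- by apply/subsetP => x /inK[i /kn /andP[_ iW] ->].
- move=> x y /inK[i ik ->] /inK[j jk ->].
  have /andP[li _] := kn i ik; have /andP[lj _] := kn j jk.
  rewrite !mem_nth //= !index_uniq //; exact: (allP (kind i ik)).
move=> x xW /inK xK.
have xs : x \in s by have := subsetP sW x xW; rewrite inE.
have xm : index x s \in m by rewrite mem_filter nth_index // xW mem_iota /= add0n index_mem.
case/orP: (kabs _ xm) => [xk|/hasP[j jk rj]].
  by case: xK; exists (index x s); rewrite ?nth_index.
have /andP[lj _] := kn j jk.
by exists (nth t0 s j); [apply/inK; exists j | rewrite xs mem_nth // index_uniq].
Qed.

(** The kernel-perfect obstruction to being BK-free, for the graph induced on [U] with [D] in the
    role of the maximum degree. For [U = setT] and [D = Delta e] the bound is [fH]. *)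
Definition KP_in (T : finType) (e : rel T) (U : {set T}) (D : nat) :=
  exists S : {set T}, [/\ S \subset U, S != set0 &
    f_KP e S (fun v => (deg e S v + (D - deg e U v)).-1)].

Lemma KP_in_criterion (T : finType) (e r : rel T) (U S : {set T}) (D : nat) :
    S \subset U -> S != set0 -> irreflexive e ->
    (forall u v, r u v -> [&& u \in S, v \in S & e u v]) ->
    (forall u v, u \in S -> v \in S -> e u v -> r u v || r v u) ->
    (forall v, v \in S -> deg e U v <= D) ->
    (forall v, v \in S ->
       deg e U v + 2 <= D + #|[set u in S | e v u && ~~ r v u]|) ->
    kernel_perfect r S ->
  KP_in e U D.
Proof.
move=> sSU S0 eirr rS er dD cr kp; exists S; split=> //.
exists (fun u v => nat_of_bool (r u v)); split.
- move=> u v; rewrite lt0b => /rS /and3P[-> -> euv] /=.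
  by apply: contraTneq euv => ->; rewrite eirr.
- by move=> u v uS vS euv; rewrite addn_gt0 !lt0b er.
- move=> v vS.
  have -> : \sum_u nat_of_bool (r v u) = #|[set u in S | e v u && r v u]|.
    rewrite -sum1dep_card [RHS]big_mkcond /=; apply: eq_bigr => u _.
    case ruv: (r v u); last by rewrite !andbF.
    by have /and3P[_ -> ->] := rS _ _ ruv.
  have : deg e S v = #|[set u in S | e v u && r v u]| + #|[set u in S | e v u && ~~ r v u]|.
    rewrite /deg -(cardsID [set u | r v u]); congr (_ + _); apply: eq_card => u;
    by rewrite !inE; case: (u \in S); case: (e v u); case: (r v u).
  have := cr v vS; have := dD v vS; lia.
move=> W sW; have [K [sKW indK absK]] := kp W sW.
exists K; split=> // [x y xK yK|x xW xK]; first by rewrite lt0b indK.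
by have [y yK rxy] := absK x xW xK; exists y; rewrite ?lt0b.
Qed.

(** The neighbours of vertex [i] that receive no arc from it are those in its list of worse ones, so
    the criterion becomes a lower bound on the length of that list. *)
Lemma KP_in_pattern (T : finType) (e : rel T) (U : {set T}) (D : nat)
    (t0 : T) (s : seq T) (adj : rel nat) (worse : seq (seq nat)) :
    symmetric e -> irreflexive e -> uniq s -> 0 < size s ->
    (forall i, i < size s -> nth t0 s i \in U) ->
    (forall i j, i < size s -> j < size s -> e (nth t0 s i) (nth t0 s j) = adj i j) ->
    kernel_pattern (size s) adj worse ->
    (forall v, v \in U -> deg e U v <= D) ->
    (forall i, i < size s -> deg e U (nth t0 s i) + 2 <= D + size (nth [::] worse i)) ->
  KP_in e U D.
Proof.
move=> esym eirr us s0 sU eadj kp dD cr.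
have sU' x : x \in s -> x \in U by move=> xs; rewrite -(nth_index t0 xs) sU ?index_mem.
have eadj' x y : x \in s -> y \in s -> e x y = adj (index x s) (index y s).
  by move=> xs ys; rewrite -eadj ?index_mem // !nth_index.
apply: (@KP_in_criterion _ e (fun x y => [&& x \in s, y \in s &
   pattern_arc adj worse (index x s) (index y s)]) U [set x in s]) => //.
- by apply/subsetP => x; rewrite inE; apply: sU'.
- by apply/set0Pn; exists (nth t0 s 0); rewrite inE mem_nth.
- by move=> u v /and3P[us' vs /andP[a _]]; rewrite !inE us' vs eadj'.
- move=> u v; rewrite !inE => us' vs; rewrite us' vs /= eadj' // => a.
  have a' : adj (index v s) (index u s).
    by rewrite -eadj' // esym eadj'.
  rewrite /pattern_arc a a' /= -negb_and; apply/negP => /andP[].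
  case/andP: kp => /allP /(_ (index u s)); rewrite mem_iota index_mem us'.
  move=> /(_ isT) /andP[_ /allP w] _.
  by move=> /w /and3P[_ _ /negbTE ->].
- by move=> v; rewrite inE => /sU'; apply: dD.
- move=> v; rewrite inE => vs.
  have iv : index v s < size s by rewrite index_mem.
  have := cr _ iv; rewrite nth_index // => /leq_trans; apply; rewrite leq_add2l.
  case/andP: kp => /allP /(_ (index v s)); rewrite mem_iota index_mem vs.
  move=> /(_ isT) /andP[uw /allP w] _.
  set ws := nth [::] worse _ in uw w *.
  rewrite -(size_map (nth t0 s)) -(card_uniqP _).
    apply/subset_leq_card/subsetP => x /mapP[j jw ->].
    have /and3P[lj aj _] := w j jw.
    rewrite !inE mem_nth //= eadj' ?mem_nth // index_uniq // aj /pattern_arc aj /=.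
    by rewrite -/ws jw /= ?andbF.
  rewrite map_inj_in_uniq // => i j iw jw /eqP.
  by have /andP[li _] := w i iw; have /andP[lj _] := w j jw; rewrite nth_uniq // => /eqP.
- exact: kernel_perfect_pattern.
Qed.

(** The join of a complete graph on four vertices with the graph [b], shifted by 4. *)
Definition pat_adj (b : rel nat) : rel nat :=
  fun i j => (i != j) && [|| i < 4, j < 4 | b (i - 4) (j - 4)].

Definition path_adj (edges : seq (nat * nat)) : rel nat :=
  fun i j => ((i, j) \in edges) || ((j, i) \in edges).

(* Vertices 0, 1, 2, 3 stand for parallel edges, the others for the two, resp. four,
   further edges; the name tells which graph these induce. *)
Definition wE2 := [:: [:: 5]; [:: 5]; [:: 4]; [:: 4]; [:: 0; 1]; [:: 2; 3]].
Definition w2K2 := [:: [:: 6; 7]; [:: 6; 7]; [:: 4; 5]; [:: 4; 5];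
  [:: 0; 1]; [:: 0; 1]; [:: 2; 3]; [:: 2; 3]].
Definition wP4 := [:: [:: 3; 5]; [:: 6; 7]; [:: 4; 7]; [:: 4; 5];
  [:: 1; 5]; [:: 1; 6]; [:: 2; 7]; [:: 0; 3]].
Definition wC4 := [:: [:: 6; 7]; [:: 7; 4]; [:: 4; 5]; [:: 5; 6];
  [:: 5; 3]; [:: 6; 0]; [:: 7; 1]; [:: 4; 2]].

Lemma pattern_E2 : kernel_pattern 6 (pat_adj (path_adj [::])) wE2.
Proof. by vm_compute. Qed.

Lemma pattern_2K2 : kernel_pattern 8 (pat_adj (path_adj [:: (0, 1); (2, 3)])) w2K2.
Proof. by vm_compute. Qed.

Lemma pattern_P4 : kernel_pattern 8 (pat_adj (path_adj [:: (0, 1); (1, 2); (2, 3)])) wP4.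
Proof. by vm_compute. Qed.

Lemma pattern_C4 :
  kernel_pattern 8 (pat_adj (path_adj [:: (0, 1); (1, 2); (2, 3); (3, 0)])) wC4.
Proof. by vm_compute. Qed.

(** * Stars and degrees in the underlying multigraph *)

Section LineGraph.
Variables (T V : finType) (ends : T -> V * V) (e : rel T) (U : {set T}) (D : nat).
Hypotheses (esym : symmetric e) (eirr : irreflexive e).
Hypothesis ends_neq : forall x, (ends x).1 != (ends x).2.
Hypothesis e_ends : forall x y, x != y ->
  e x y = [|| (ends x).1 == (ends y).1, (ends x).1 == (ends y).2,
              (ends x).2 == (ends y).1 | (ends x).2 == (ends y).2].
Hypothesis degD : forall v, v \in U -> deg e U v <= D.
Hypothesis cliqueD : forall K : {set T}, K \subset U -> clique e K -> #|K| < D.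

Definition inc v t := (v == (ends t).1) || (v == (ends t).2).
Definition star v := [set t in U | inc v t].

Lemma star_sub v : star v \subset U.
Proof. by apply/subsetP => t; rewrite inE => /andP[]. Qed.

Lemma e_inc v t t' : t != t' -> inc v t -> inc v t' -> e t t'.
Proof.
move=> /e_ends ->; rewrite /inc => /orP[] /eqP <- /orP[] /eqP <-; by rewrite eqxx ?orbT.
Qed.

Lemma e_incP t t' : e t t' -> exists2 v, inc v t & inc v t'.
Proof.
have [->|tt'] := eqVneq t t'; first by rewrite eirr.
rewrite e_ends // /inc => /or4P[] /eqP E;
  by [exists (ends t).1; rewrite ?E eqxx ?orbT | exists (ends t).2; rewrite ?E eqxx ?orbT].
Qed.

Lemma inc2 x y t v : x != y -> inc x t -> inc y t -> inc v t = (v == x) || (v == y).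
Proof.
rewrite /inc => xy /orP[] /eqP ex /orP[] /eqP ey; move: xy; rewrite ex ey ?eqxx //= => _.
by rewrite orbC.
Qed.

Lemma clique_star v : clique e (star v).
Proof.
apply/forall_inP => t; rewrite inE => /andP[_ it]; apply/forall_inP => t'.
by rewrite inE => /andP[_ it']; apply/implyP => tt'; apply: e_inc it it'.
Qed.

Lemma star_lt v : #|star v| < D.
Proof. exact: cliqueD (star_sub v) (clique_star v). Qed.

Lemma deg_star x y t : x != y -> t \in star x :&: star y ->
  (deg e U t).+1 = #|star x :|: star y|.
Proof.
move=> xy; rewrite !inE => /andP[/andP[tU tx] /andP[_ ty]].
rewrite (cardsD1 t) !inE tU tx /= add1n; congr _.+1; apply: eq_card => u.
rewrite !inE; have [uU|] := boolP (u \in U); last by rewrite !andbF.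
have [->|ut] := eqVneq u t; first by rewrite eirr.
apply/idP/idP => /= [/e_incP[v]|].
  by rewrite (inc2 _ xy) // => /orP[]/eqP-> ->; rewrite ?orbT.
by rewrite esym; case/orP => iu; [apply: e_inc ut iu tx | apply: e_inc ut iu ty].
Qed.

Lemma low_degree_KP t : t \in U -> deg e U t + 2 <= D -> KP_in e U D.
Proof.
move=> tU dt; apply: (@KP_in_criterion _ e (fun _ _ => false) U [set t]) => //.
- by rewrite sub1set.
- by apply/set0Pn; exists t; rewrite inE.
- by move=> u v /set1P -> /set1P ->; rewrite eirr.
- by move=> v /set1P ->; apply: degD.
- by move=> v /set1P ->; apply: leq_trans dt (leq_addr _ _).
by move=> W sW; exists W; split=> // x ->.
Qed.

(** * Four parallel edges *)

Section Parallel.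
Variables (x y : V).
Hypotheses (xy : x != y) (mul4 : 4 <= #|star x :&: star y|).

(** An edge joining [x] and [y] has degree [#|star x :|: star y| - 1], which fixes the list length
    it needs; for every other edge the degree is at most [D] and two worse neighbours suffice. *)
Lemma parallel_pattern_KP (b : seq T) badj worse :
    uniq b ->
    (forall z, z \in b -> (z \in star x :|: star y) && (z \notin star x :&: star y)) ->
    (forall t0 i j, i < size b -> j < size b -> i != j -> e (nth t0 b i) (nth t0 b j) = badj i j) ->
    kernel_pattern (4 + size b) (pat_adj badj) worse ->
    (forall i, i < 4 -> #|star x :|: star y|.+1 <= D + size (nth [::] worse i)) ->
    (forall i, i < size b -> 2 <= size (nth [::] worse (4 + i))) ->
  KP_in e U D.
Proof.
move=> ub hb eb kp d4 db.
pose c := take 4 (enum (star x :&: star y)).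
have sc : size c = 4 by rewrite size_takel // -cardE.
have cM z : z \in c -> z \in star x :&: star y by move/mem_take; rewrite mem_enum.
have [t0 _] : exists t0, t0 \in c by case: c sc {cM} => // t0 ? _; exists t0; rewrite inE eqxx.
have uc : uniq c by rewrite take_uniq ?enum_uniq.
have us : uniq (c ++ b).
  rewrite cat_uniq uc ub andbT /=; apply/hasPn => z /hb /andP[_].
  by apply: contra => /cM.
have ec z w : z \in c -> w \in star x :|: star y -> z != w -> e z w.
  move=> /cM; rewrite !inE => /andP[/andP[_ zx] /andP[_ zy]].
  by move=> /orP[] /andP[_ iw] zw; [apply: e_inc zw zx iw | apply: e_inc zw zy iw].
have cin z : z \in c ++ b -> z \in star x :|: star y.
  rewrite mem_cat => /orP[/cM|/hb /andP[] //]; rewrite !inE => /andP[-> _] //.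
have cU z : z \in c ++ b -> z \in U.
  by move/cin => /setUP[]; apply/subsetP; apply: star_sub.
apply: (@KP_in_pattern _ e U D t0 (c ++ b) (pat_adj badj) worse) => //.
- by rewrite size_cat sc.
- by move=> i li; apply: cU; rewrite mem_nth.
- move=> i j li lj; rewrite /pat_adj.
  have [->|ij] := eqVneq i j; first by rewrite eirr.
  have nij : nth t0 (c ++ b) i != nth t0 (c ++ b) j by rewrite nth_uniq.
  have [i4|i4] /= := ltnP i 4.
    by apply: ec => //; [rewrite nth_cat sc i4 mem_nth ?sc | rewrite cin ?mem_nth].
  have [j4|j4] /= := ltnP j 4.
    rewrite esym; apply: ec; last by rewrite eq_sym.
      by rewrite nth_cat sc j4 mem_nth ?sc.
    by rewrite cin ?mem_nth.
  rewrite !nth_cat sc (ltnNge i) (ltnNge j) i4 j4 /=; move: li lj; rewrite size_cat sc => li lj.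
  by apply: eb; lia.
- by rewrite size_cat sc.
move=> i; rewrite size_cat sc => li.
have [i4|i4] := ltnP i 4.
  rewrite nth_cat sc i4 addn2 (@deg_star x y) //; first exact: d4.
  by apply: cM; rewrite mem_nth ?sc.
apply: leq_add; first by apply: degD; apply: cU; rewrite mem_nth // size_cat sc.
by have := db (i - 4); rewrite subnKC //; apply; lia.
Qed.

(** [W] is too large for a clique, and edges sharing [x] or [y] are adjacent, so a nonadjacent pair
    consists of one edge at [x] only and one at [y] only. *)
Lemma nonadjacent_pair (W : {set T}) : W \subset star x :|: star y -> D <= #|W| ->
  exists a b, [/\ a \in W, b \in W, a \in star x :\: star y, b \in star y :\: star x & ~~ e a b].
Proof.
move=> sW leD.
have : ~~ clique e W.
  apply/negP => cW; have : #|W| < D.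
    apply: cliqueD cW; apply: subset_trans sW _.
    by rewrite subUset !star_sub.
  by rewrite ltnNge leD.
rewrite negb_forall_in => /exists_inP[a aW]; rewrite negb_forall_in => /exists_inP[b bW].
rewrite negb_imply => /andP[ab nab].
have sh v : inc v a -> inc v b -> False by move=> ia ib; rewrite (e_inc ab ia ib) in nab.
have := subsetP sW a aW; have := subsetP sW b bW; rewrite !inE.
case/orP => /andP[bU ib]; case/orP => /andP[aU ia]; try by case: (sh _ ia ib).
  exists b, a; rewrite !inE aW bW aU bU ia ib esym nab /=; split=> //; rewrite andbT.
    by apply/negP => ib'; case: (sh y).
  by apply/negP => ia'; case: (sh x).
exists a, b; rewrite !inE aW bW aU bU ia ib nab /=; split=> //; rewrite andbT.
  by apply/negP => ia'; case: (sh y).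
by apply/negP => ib'; case: (sh x).
Qed.

Lemma nonadjacent_pair_KP : #|star x :|: star y| = D -> KP_in e U D.
Proof.
move=> cD; case: (@nonadjacent_pair (star x :|: star y)) => //; first by rewrite cD.
move=> a [b [_ _ aS bS nab]].
move: aS bS; rewrite !in_setD => /andP[ay ax] /andP[bx yb].
apply: (@parallel_pattern_KP [:: a; b] (path_adj [::]) wE2 _ _ _ pattern_E2).
- by rewrite /= inE andbT; apply: contraNneq ay => ->.
- by move=> z; rewrite !in_cons in_nil orbF => /orP[] /eqP ->;
    rewrite in_setU in_setI ?ax ?yb (negbTE bx, negbTE ay) ?andbF ?orbT.
- by move=> t0 [|[|i]] [|[|j]] //= _ _ _; rewrite ?(negbTE nab) // esym (negbTE nab).
- by case=> [|[|[|[|i]]]] //= _; rewrite cD; lia.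
- by case=> [|[|i]].
Qed.

(** [a1 a2] meet at [x] and [b1 b2] at [y], so only the adjacency of [a1 b2] and of [a2 b1] is open.
    The four cases induce a 4-cycle, a path (twice) or two disjoint edges. *)
Lemma two_nonadjacent_pairs_KP a1 a2 b1 b2 : #|star x :|: star y| = D.+1 ->
    a1 \in star x :\: star y -> a2 \in star x :\: star y ->
    b1 \in star y :\: star x -> b2 \in star y :\: star x ->
    a1 != a2 -> b1 != b2 -> ~~ e a1 b1 -> ~~ e a2 b2 ->
  KP_in e U D.
Proof.
move=> cD; rewrite !in_setD => /andP[ay1 ax1] /andP[ay2 ax2] /andP[bx1 by1] /andP[bx2 by2].
move=> a12 b12 /negbTE n1 /negbTE n2.
have ab a b : a \notin star y -> b \in star y -> (a == b) = false.
  by move=> ay yb; apply: contraNF ay => /eqP ->.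
have ea : e a1 a2.
  by move: ax1 ax2; rewrite !inE => /andP[_ i1] /andP[_ i2]; apply: e_inc a12 i1 i2.
have eb : e b1 b2.
  by move: by1 by2; rewrite !inE => /andP[_ i1] /andP[_ i2]; apply: e_inc b12 i1 i2.
have side (b : seq T) : {subset b <= [:: a1; a2; b1; b2]} -> forall z, z \in b ->
    (z \in star x :|: star y) && (z \notin star x :&: star y).
  move=> sb z /sb; rewrite !in_cons in_nil orbF in_setU in_setI.
  by case/or4P => /eqP ->; rewrite ?ax1 ?ax2 ?by1 ?by2 ?(negbTE ay1) ?(negbTE ay2)
    ?(negbTE bx1) ?(negbTE bx2) ?orbT.
have ba a b : a \notin star y -> b \in star y -> (b == a) = false by rewrite eq_sym; apply: ab.
have sz8 (w : seq (seq nat)) : all (fun s => 2 <= size s) w -> size w = 8 ->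
    (forall i, i < 4 -> #|star x :|: star y|.+1 <= D + size (nth [::] w i)) /\
    (forall i, i < 4 -> 2 <= size (nth [::] w (4 + i))).
  move=> /(all_nthP [::]) w2 sw; split=> i i4; last first.
    by apply: w2; rewrite sw -[8]/(4 + 4) ltn_add2l.
  have : 2 <= size (nth [::] w i) by apply: w2; rewrite sw (leq_trans i4).
  by rewrite cD -(leq_add2l D) addn2.
have build s edges w : perm_eq s [:: a1; a2; b1; b2] -> size w = 8 ->
    all (fun r => 2 <= size r) w ->
    (forall t0 i j, i < 4 -> j < 4 -> i != j ->
       e (nth t0 s i) (nth t0 s j) = path_adj edges i j) ->
    kernel_pattern 8 (pat_adj (path_adj edges)) w -> KP_in e U D.
  move=> ps sw w2 adj kp; have [d4 db] := sz8 w w2 sw.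
  have s4 : size s = 4 by rewrite (perm_size ps).
  apply: (@parallel_pattern_KP s (path_adj edges) w); rewrite ?s4 //.
    rewrite (perm_uniq ps) /= !inE !negb_or a12 b12.
    by rewrite !ab.
  by apply: side => z; rewrite (perm_mem ps).
have [e12|/negbTE e12] := boolP (e a1 b2); have [e21|/negbTE e21] := boolP (e a2 b1).
- apply: (build [:: a1; a2; b1; b2] [:: (0, 1); (1, 2); (2, 3); (3, 0)] wC4 _ _ _ _ pattern_C4) => //.
  + by move=> t0 [|[|[|[|i]]]] [|[|[|[|j]]]] //= _ _ _;
      rewrite ?(ea, eb, e12, e21, n1, n2) // esym ?(ea, eb, e12, e21, n1, n2).
- apply: (build [:: a2; a1; b2; b1] [:: (0, 1); (1, 2); (2, 3)] wP4 _ _ _ _ pattern_P4) => //.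
  + by rewrite (perm_catCA [:: a2] [:: a1] [:: b2; b1]) /= !perm_cons (perm_catC [:: b2]).
  + by move=> t0 [|[|[|[|i]]]] [|[|[|[|j]]]] //= _ _ _;
      rewrite ?(ea, eb, e12, e21, n1, n2) // esym ?(ea, eb, e12, e21, n1, n2).
- apply: (build [:: a1; a2; b1; b2] [:: (0, 1); (1, 2); (2, 3)] wP4 _ _ _ _ pattern_P4) => //.
  + by move=> t0 [|[|[|[|i]]]] [|[|[|[|j]]]] //= _ _ _;
      rewrite ?(ea, eb, e12, e21, n1, n2) // esym ?(ea, eb, e12, e21, n1, n2).
- apply: (build [:: a1; a2; b1; b2] [:: (0, 1); (2, 3)] w2K2 _ _ _ _ pattern_2K2) => //.
  + by move=> t0 [|[|[|[|i]]]] [|[|[|[|j]]]] //= _ _ _;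
      rewrite ?(ea, eb, e12, e21, n1, n2) // esym ?(ea, eb, e12, e21, n1, n2).
Qed.

(** Unless an edge [xy] has low degree, the union of the two stars has [D] or [D.+1] elements; one
    nonadjacent pair suffices in the first case and two disjoint ones in the second. *)
Lemma high_multiplicity_KP : KP_in e U D.
Proof.
have [t tM] : exists t, t \in star x :&: star y.
  by apply/set0Pn; rewrite -card_gt0; apply: leq_trans mul4.
have tU : t \in U by move: tM; rewrite !inE => /andP[/andP[]].
have dt := deg_star xy tM.
have [low|high] := leqP (deg e U t + 2) D; first exact: low_degree_KP low.
have [eqD|neqD] := eqVneq #|star x :|: star y| D; first exact: nonadjacent_pair_KP.
have cD : #|star x :|: star y| = D.+1 by have := degD tU; lia.
have [//||a1 [b1 [a1W b1W a1S b1S n1]]] := @nonadjacent_pair (star x :|: star y).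
  by rewrite cD.
(* Removing [a1], or [b1], still leaves too many edges for a clique, so there is a pair avoiding
   [a1] and a pair avoiding [b1]. If neither is disjoint from the first pair, they are [(a, b1)] and
   [(a1, b')], which are disjoint from each other. *)
have rest z : z \in star x :|: star y -> D <= #|(star x :|: star y) :\ z|.
  by move=> zW; move: cD; rewrite (cardsD1 z) zW; lia.
have [||a [b [/setD1P[aa1 _] _ aS bS n2]]] :=
  @nonadjacent_pair ((star x :|: star y) :\ a1); rewrite ?subD1set ?rest //.
have [||a' [b' [_ /setD1P[bb1 _] aS' bS' n3]]] :=
  @nonadjacent_pair ((star x :|: star y) :\ b1); rewrite ?subD1set ?rest //.
have [bb|bb] := eqVneq b b1; last first.
  by apply: (@two_nonadjacent_pairs_KP a1 a b1 b) => //; rewrite eq_sym.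
have [aa|aa] := eqVneq a' a1; last first.
  by apply: (@two_nonadjacent_pairs_KP a1 a' b1 b') => //; rewrite eq_sym.
rewrite {}bb {}aa in n2 n3 bS aS' *.
by apply: (@two_nonadjacent_pairs_KP a a1 b1 b') => //; rewrite eq_sym.
Qed.

End Parallel.

(** * Bipartite subgraphs with owned edges *)

Section Simple.
Hypothesis degD1 : forall t, t \in U -> D <= (deg e U t).+1.

(** Adjacency in the simple graph underlying the multigraph with edge set [U]. *)
Definition nb x y := (x != y) && (star x :&: star y != set0).
Definition nbs x := [set y | nb x y].

Lemma nb_sym : symmetric nb.
Proof. by move=> x y; rewrite /nb eq_sym setIC. Qed.

Lemma nb_irr : irreflexive nb.
Proof. by move=> x; rewrite /nb eqxx. Qed.

Lemma nb_sum x y : nb x y -> D + #|star x :&: star y| <= #|star x| + #|star y|.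
Proof.
case/andP=> xy /set0Pn[t tM]; rewrite -cardsUI leq_add2r -(deg_star xy tM) degD1 //.
by move: tM; rewrite !inE => /andP[/andP[]].
Qed.

(** As [#|star y| < D], the number of neighbours to which [t] must send no arc is at most the number
    of edges at [x] that do not end in [y]. *)
Lemma star_need x y t : x != y -> t \in star x :&: star y ->
  deg e U t + 2 + #|star x :&: star y| <= D + #|star x|.
Proof.
move=> xy tM; have := cardsUI (star x) (star y); rewrite -(deg_star xy tM).
by have := star_lt y; lia.
Qed.

Lemma two_level_inj (a b : bool) n i j : i < n -> j < n -> a * n + i = b * n + j -> i = j.
Proof. by case: a; case: b; rewrite ?mul1n ?mul0n; lia. Qed.

(** [o p] holds the owner of the simple edge [p], if any. The demand [minn 2 #|nbs v|.-1] is two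
    owned edges, or one if [v] has two neighbours. All parallel edges over a pair in [A] are taken
    into [S]. *)
Lemma bipartite_ownership_KP (side : pred V) (A : {set V * V}) (o : V * V -> {set V}) :
    A != set0 ->
    (forall p, p \in A -> [&& side p.1, ~~ side p.2 & nb p.1 p.2]) ->
    (forall p v, v \in o p -> (p \in A) && (v \in [set p.1; p.2])) ->
    (forall p, #|o p| <= 1) ->
    (forall p v, p \in A -> v \in [set p.1; p.2] ->
       minn 2 #|nbs v|.-1 <= #|[set q | v \in o q]|) ->
  KP_in e U D.
Proof.
move=> A0 Aside oA o1 odem.
pose lt t := if side (ends t).1 then (ends t).1 else (ends t).2.
pose rt t := if side (ends t).1 then (ends t).2 else (ends t).1.
pose pr t := (lt t, rt t).
pose S := [set t in U | pr t \in A].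
have incE v t : inc v t = (v == lt t) || (v == rt t).
  by rewrite /inc /lt /rt; case: ifP => // _; rewrite orbC.
have lrt t : lt t != rt t.
  by rewrite /lt /rt; case: ifP => // _; rewrite eq_sym.
have prE u w t : side u -> ~~ side w -> inc u t -> inc w t -> pr t = (u, w).
  move=> su sw; rewrite /inc /pr /lt /rt => /orP[]/eqP eu /orP[]/eqP ew;
    by rewrite -?eu -?ew ?su ?(negbTE sw) //; move: su sw; rewrite eu ew => ->.
have SA t : t \in S -> [&& t \in U, side (lt t), ~~ side (rt t) & pr t \in A].
  by rewrite inE => /andP[-> pA]; have /and3P[-> -> _] := Aside _ pA; rewrite pA.
(* [v] ranks the edges that it does not own above those that it owns. *)
pose key v t := (v \notin o (pr t)) * #|T| + enum_rank t.
have keyI v t t' : key v t = key v t' -> t = t'.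
  move=> eqk; apply: enum_rank_inj; apply: val_inj; move: eqk; rewrite /key /=.
  have lt1 : enum_rank t < #|T| := ltn_ord _; have lt2 : enum_rank t' < #|T| := ltn_ord _.
  exact: two_level_inj lt1 lt2.
pose r t t' := [&& t \in S, t' \in S & (lt t == lt t') && (key (lt t) t < key (lt t') t') ||
                      (rt t == rt t') && (key (rt t) t < key (rt t') t')].
apply: (@KP_in_criterion _ e r U S) => //.
- by apply/subsetP => t; rewrite inE => /andP[].
- have /set0Pn[[u w] pA] := A0; have /and3P[/= su sw /andP[uw /set0Pn[t]]] := Aside _ pA.
  rewrite !inE => /andP[/andP[tU tu] /andP[_ tw]].
  by apply/set0Pn; exists t; rewrite inE tU (prE u w).
- move=> t t' /and3P[-> -> /=] /orP[] /andP[/eqP E ltk].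
    apply: (@e_inc (lt t)); rewrite ?incE -?E ?eqxx //.
    by apply: contraTneq ltk => <-; rewrite ltnn.
  apply: (@e_inc (rt t)); rewrite ?incE -?E ?eqxx ?orbT //.
  by apply: contraTneq ltk => <-; rewrite ltnn.
- move=> t t' tS t'S ett'; rewrite /r tS t'S /=.
  have tt' : t != t' by apply: contraTneq ett' => ->; rewrite eirr.
  have /and4P[_ sl sr _] := SA _ tS; have /and4P[_ sl' sr' _] := SA _ t'S.
  have kne v : (key v t < key v t') || (key v t' < key v t).
    by rewrite -neq_ltn; apply: contra tt' => /eqP /keyI ->.
  have [w] := e_incP ett'; rewrite !incE => /orP[] /eqP -> /orP[] /eqP E.
  + by rewrite E eqxx /=; case/orP: (kne (lt t')) => ->; rewrite ?orbT.
  + by move: sl; rewrite E (negbTE sr').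
  + by move: sl'; rewrite -E (negbTE sr).
  + by rewrite E eqxx /=; case/orP: (kne (rt t')) => ->; rewrite ?orbT.
- by move=> t /SA /and4P[tU _ _ _]; apply: degD.
- move=> t tS; have /and4P[tU sl sr pA] := SA _ tS.
  (* A pair has at most one owner, so some end [z] of [t] does not own it. The edges that [z] owns
     rank below [t] at [z], and they are not parallel to [t], so [t] sends them no arc. *)
  have [z zt zo] : exists2 z, inc z t & z \notin o (pr t).
    have [lo|lo] := boolP (lt t \in o (pr t)); last by exists (lt t); rewrite // incE eqxx.
    exists (rt t); first by rewrite incE eqxx orbT.
    apply/negP => ro; have := o1 (pr t); rewrite leqNgt => /negP; apply.
    by apply/card_gt1P; exists (lt t), (rt t).
  pose Q := [set t' in S | z \in o (pr t')].
  have sQ : Q \subset [set u in S | e t u && ~~ r t u].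
    apply/subsetP => t' /setIdP[t'S zo'].
    have /andP[_ zi'] := oA _ _ zo'.
    have zt' : inc z t' by rewrite incE; move: zi'; rewrite !inE.
    have tt' : t != t' by apply: contraNneq zo => ->.
    have kz : key z t' < key z t.
      by rewrite /key zo' zo /= mul0n mul1n add0n ltn_addr.
    rewrite inE t'S (e_inc tt' zt zt') /=; apply/negP => /and3P[_ _].
    have /and4P[_ sl' sr' _] := SA _ t'S.
    have notboth : ~ (lt t = lt t' /\ rt t = rt t').
      by case=> E1 E2; move: zo; rewrite /pr E1 E2 zo'.
    move: zt zt'; rewrite !incE => /orP[] /eqP Ez /orP[] /eqP Ez'.
    + case/orP => /andP[/eqP E]; first by rewrite -E -Ez ltnNge ltnW.
      by case: notboth; rewrite -Ez -Ez'.
    + by move: sl; rewrite -Ez Ez' (negbTE sr').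
    + by move: sl'; rewrite -Ez' Ez (negbTE sr).
    + case/orP => /andP[/eqP E]; last by rewrite -E -Ez ltnNge ltnW.
      by case: notboth; rewrite -Ez -Ez'.
  apply: (@leq_trans (D + #|Q|)); last by rewrite leq_add2l subset_leq_card.
  have ownQ : #|[set q | z \in o q]| <= #|Q|.
    apply: leq_trans (leq_imset_card pr Q); apply/subset_leq_card/subsetP => q.
    rewrite inE => zq; have /andP[qA _] := oA _ _ zq.
    have /and3P[s1 s2 /andP[_ /set0Pn[t']]] := Aside _ qA.
    rewrite !inE => /andP[/andP[t'U i1] /andP[_ i2]].
    have prq : pr t' = q by rewrite (prE q.1 q.2) //; case: (q).
    by apply/imsetP; exists t'; rewrite ?inE ?prq ?t'U ?qA.
  have zA : z \in [set (pr t).1; (pr t).2] by rewrite !inE -incE.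
  have := odem _ _ pA zA; have [le2|gt2] := leqP #|nbs z| 2; last first.
    rewrite (minn_idPl _); last by lia.
    move=> own2; apply: leq_add; [exact: degD | exact: leq_trans own2 ownQ].
  (* With at most two neighbours, all edges at [z] not going to [y] go to a single vertex [w1]. The
     pair owned by [z] is not that of [t], hence it is the one with [w1], so all these edges lie in
     [Q], as many as [star_need] asks for. *)
  move=> own1; pose y := if z == lt t then rt t else lt t.
  have zy : z != y.
    by rewrite /y; move: zt; rewrite incE; case: eqP => [-> _|_ /= /eqP ->] //; rewrite eq_sym.
  have yt : inc y t by rewrite incE /y; case: ifP; rewrite eqxx ?orbT.
  have tzy : t \in star z :&: star y by rewrite !inE tU zt yt.
  have nzy : nb z y by rewrite /nb zy; apply/set0Pn; exists t.
  suff: #|star z| <= #|star z :&: star y| + #|Q| by have := star_need zy tzy; lia.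
  rewrite -(cardsID (star y) (star z)) leq_add2l; apply: subset_leq_card.
  have [-> |/set0Pn[t1 t1D]] := eqVneq (star z :\: star y) set0; first exact: sub0set.
  have other t' : t' \in star z :\: star y -> exists w, [/\ inc w t', w != y & nb z w].
    rewrite !inE => /andP[]; case t'U: (t' \in U) => //= yt' zt'.
    pose w := if z == lt t' then rt t' else lt t'.
    have zw : z != w.
      by rewrite /w; move: zt'; rewrite incE; case: eqP => [-> _|_ /= /eqP ->] //; rewrite eq_sym.
    have wt : inc w t' by rewrite incE /w; case: ifP; rewrite eqxx ?orbT.
    exists w; rewrite wt; split=> //; first by apply: contraNneq yt' => <-.
    by rewrite /nb zw; apply/set0Pn; exists t'; rewrite !inE t'U zt' wt.
  have [w1 [_ w1y nzw1]] := other _ t1D.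
  have nbs2 : nbs z = [set y; w1].
    apply/eqP; rewrite eq_sym eqEcard cards2 eq_sym w1y le2 andbT.
    by apply/subsetP => v; rewrite !inE => /orP[] /eqP ->.
  have [q qo] : exists q, z \in o q.
    have : 0 < #|[set q | z \in o q]|.
      by apply: leq_trans own1; rewrite nbs2 cards2 eq_sym w1y.
    by rewrite card_gt0 => /set0Pn[q]; rewrite inE => ?; exists q.
  apply/subsetP => t' t'D; have [w [wt' wy nzw]] := other _ t'D.
  have nbsz v : nb z v -> (v == y) || (v == w1) by rewrite -in_set2 -nbs2 inE.
  have ww1 : w = w1 by have := nbsz w nzw; rewrite (negbTE wy) => /eqP.
  move: t'D; rewrite !inE => /andP[]; case t'U: (t' \in U) => //= yt' zt'.
  have /andP[qA zq] := oA _ _ qo.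
  have /and3P[s1 s2 nq] := Aside _ qA.
  have qpr : pr t = q \/ pr t' = q.
    have qw (v : V) : nb z v -> v = y \/ v = w.
      by rewrite ww1 => /nbsz /orP[] /eqP ->; [left | right].
    case: q zq s1 s2 nq {qo qA} => q1 q2 /=; rewrite !inE => /orP[] /eqP <- s1 s2 nq.
      by case: (qw q2 nq) => Ev; rewrite Ev in s2 *; [left | right]; apply: prE.
    rewrite nb_sym in nq.
    by case: (qw q1 nq) => Ev; rewrite Ev in s1 *; [left | right]; apply: prE.
  case: qpr => Eq; first by rewrite Eq qo in zo.
  by rewrite Eq qA qo.
apply: (@stable_kernel T V V lt rt (fun t => key (lt t) t) (fun t => key (rt t) t)).
by move=> t t' -> /keyI.
Qed.

Lemma dense_bipartite_KP (side : pred V) (W0 : {set V}) (A : {set V * V}) :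
    W0 != set0 -> (forall v, v \in W0 -> 2 <= #|nbs v|) ->
    (forall p, p \in A -> [&& side p.1, ~~ side p.2 & nb p.1 p.2]) ->
    \sum_(v in W0) minn 2 #|nbs v|.-1 <= #|[set p in A | (p.1 \in W0) && (p.2 \in W0)]| ->
  KP_in e U D.
Proof.
move=> W00 nbs2 Aside dense; pose dem v := minn 2 #|nbs v|.-1.
pose AW (W : {set V}) := [set p in A | (p.1 \in W) && (p.2 \in W)].
pose P (W : {set V}) := (W != set0) && (\sum_(v in W) dem v <= #|AW W|).
(* In an inclusion-minimal dense set [W], any [X] touches enough edges, as [W :\: X]
   is not dense: this is Hall's condition. *)
have [|W /minsetP[/andP[WN0 denseW] minW] sW] := @minset_exists _ P W0.
  by rewrite /P W00.
pose al p := if p \in AW W then [set p.1; p.2] else set0.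
have [X|o [oal o1 odem]] := @hall_orientation _ _ al (fun v => if v \in W then dem v else 0).
  set touch := [set p | _].
  have sub : AW W \subset touch :|: AW (W :\: X).
    apply/subsetP => p pW; rewrite in_setU inE /al pW.
    move: pW; rewrite /AW !inE => /andP[pA /andP[p1 p2]].
    rewrite pA p1 p2 !andbT /=; case: (boolP (p.1 \in X)) => [x1|_] /=.
      by apply/orP; left; apply/pred0Pn; exists p.1; rewrite /= !inE eqxx x1.
    case: (boolP (p.2 \in X)) => [x2|_]; last by rewrite orbT.
    by rewrite orbF; apply/pred0Pn; exists p.2; rewrite /= !inE eqxx x2 orbT.
  have c := leq_trans (subset_leq_card sub) (leq_card_setU _ _).
  have defX : \sum_(v in X) (if v \in W then dem v else 0) = \sum_(v in W :&: X) dem v.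
    by rewrite -big_mkcondr; apply: eq_bigl => v; rewrite inE andbC.
  have defW : \sum_(v in W) dem v = \sum_(v in W :&: X) dem v + \sum_(v in W :\: X) dem v.
    exact: big_setID.
  rewrite defX; rewrite defW in denseW.
  have [E0|N0] := eqVneq (W :\: X) set0.
    have A0 : AW (W :\: X) = set0 by apply/setP => p; rewrite E0 !inE !andbF.
    by move: denseW c; rewrite A0 E0 big_set0 cards0; lia.
  have [/minW EW|] := boolP (P (W :\: X)).
    have disj : W :&: X = set0.
      apply/setP => v; rewrite !inE; apply/negP => /andP[vW vX].
      by move: (vW); rewrite -EW ?subsetDl // inE vX.
    by rewrite disj big_set0.
  rewrite /P N0 andTb -ltnNge => lt.
  rewrite -(leq_add2r (\sum_(v in W :\: X) dem v)).
  by apply: (leq_trans denseW); apply: (leq_trans c); rewrite leq_add2l ltnW.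
have oW p v : v \in o p -> (p \in AW W) && (v \in [set p.1; p.2]).
  by move/(subsetP (oal p)); rewrite /al; case: (p \in AW W); rewrite // inE.
apply: (@bipartite_ownership_KP side (AW W) o) => //.
- have [v vW] := set0Pn _ WN0; have := odem v; rewrite vW => own.
  have : 0 < #|[set p | v \in o p]|.
    by apply: leq_trans own; have := nbs2 v (subsetP sW v vW); rewrite /dem; lia.
  rewrite card_gt0 => /set0Pn[p]; rewrite inE => /oW /andP[pW _].
  by apply/set0Pn; exists p.
- by move=> p; rewrite inE => /andP[/Aside].
move=> p v; rewrite inE => /andP[_ /andP[p1 p2]] vp.
have vW : v \in W by move: vp; rewrite !inE => /orP[]/eqP ->.
by have := odem v; rewrite vW.
Qed.

Lemma other_end x t : inc x t -> exists2 y, x != y & inc y t.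
Proof.
rewrite /inc => /orP[] /eqP ->; [exists (ends t).2 | exists (ends t).1];
  by rewrite ?eqxx ?orbT // eq_sym.
Qed.

Lemma nb_other_end x t : t \in star x -> exists2 y, nb x y & t \in star y.
Proof.
rewrite inE => /andP[tU xt]; have [y xy yt] := other_end xt.
exists y; rewrite ?inE ?tU // /nb xy; apply/set0Pn; exists t; by rewrite !inE tU xt yt.
Qed.

Lemma nb_star x y : nb x y -> 0 < #|star x :&: star y|.
Proof. by case/andP=> _; rewrite card_gt0. Qed.

(** For a neighbour [y], the degree sum is at least [D] plus the multiplicity while [#|star y| < D],
    so some edge at [x] does not end in [y]. *)
Lemma nbs_ge2 x : 0 < #|star x| -> 2 <= #|nbs x|.
Proof.
rewrite card_gt0 => /set0Pn[t /nb_other_end[y xy _]].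
have := nb_sum xy; have := star_lt y => lty sumxy.
have : 0 < #|star x :\: star y| by have := cardsID (star y) (star x); lia.
rewrite card_gt0 => /set0Pn[t']; rewrite in_setD => /andP[yt' /nb_other_end[w xw wt']].
apply/card_gt1P; exists y, w; rewrite !inE xy xw; split=> //.
by apply: contraNneq yt' => ->.
Qed.

(** * Counting when multiplicities are at most three *)

Section LowMultiplicity.
Hypothesis mul3 : forall x y, x != y -> #|star x :&: star y| <= 3.
Hypothesis D69 : 69 <= D.

Lemma star_le_nbs x : #|star x| <= 3 * #|nbs x|.
Proof.
apply: (@leq_trans (\sum_(y in nbs x) #|star x :&: star y|)); last first.
  rewrite mulnC -sum_nat_const; apply: leq_sum => y; rewrite inE => /andP[xy _].
  exact: mul3.
have -> : \sum_(y in nbs x) #|star x :&: star y| =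
    \sum_(t in star x) \sum_(y in nbs x) (t \in star y).
  rewrite exchange_big; apply: eq_bigr => y _; rewrite -sum1_card big_mkcond [RHS]big_mkcond /=.
  by apply: eq_bigr => t _; rewrite in_setI; case: (t \in star x); case: (t \in star y).
rewrite -sum1_card; apply: leq_sum => t /nb_other_end[y xy ty].
by rewrite (bigD1 y) /= ?ty //; rewrite inE.
Qed.

(** The threshold is half of 69: two adjacent vertices of degree at most 34 would have degree sum
    below [D + 1]. Vertices without an edge in [U] are in neither set. *)
Let X := [set v | 0 < #|star v| <= 34].
Let Y := [set v | 35 <= #|star v|].

Lemma nb_X x y : x \in X -> nb x y -> y \in Y.
Proof. by rewrite !inE => /andP[_ xX] xy; have := nb_sum xy; have := nb_star xy; lia. Qed.

Lemma disjoint_XY : [disjoint X & Y].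
Proof. by rewrite -setI_eq0; apply/eqP/setP => x; rewrite !inE; lia. Qed.

Lemma sum_XY (F : V -> nat) :
  \sum_(x in X :|: Y) F x = \sum_(x in X) F x + \sum_(y in Y) F y.
Proof. by rewrite -bigU ?disjoint_XY //; apply: eq_bigl => x; rewrite in_setU. Qed.

Lemma nbs_sum v : #|nbs v| = \sum_(x in X) nb v x + \sum_(y in Y) nb v y.
Proof.
have -> : #|nbs v| = \sum_(x in X :|: Y) nb v x.
  rewrite -sum1_card big_mkcond [RHS]big_mkcond; apply: eq_bigr => x _.
  rewrite inE; case vx: (nb v x); last by case: ifP.
  have x0 : 0 < #|star x|.
    by apply: leq_trans (nb_star vx) _; rewrite setIC subset_leq_card // subsetIl.
  by rewrite !inE x0 /= leqNgt orNb.
exact: sum_XY.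
Qed.

Lemma card_pairs (P Q : {set V}) :
  #|[set p : V * V | [&& p.1 \in P, p.2 \in Q & nb p.1 p.2]]| =
  \sum_(x in P) \sum_(y in Q) nb x y.
Proof.
rewrite pair_big /= -sum1dep_card big_mkcond [RHS]big_mkcond /=.
by apply: eq_bigr => p _; case: (p.1 \in P); case: (p.2 \in Q); case: (nb _ _).
Qed.

Lemma weighted_count :
  6 * (\sum_(x in X) minn 2 #|nbs x|.-1) + 36 * #|Y| <=
  6 * (\sum_(x in X) \sum_(y in Y) nb x y) + 3 * (\sum_(y in Y) \sum_(z in Y) nb y z).
Proof.
(* A vertex [x] of [X] can give away [|nbs x| - 1] edges if it has two neighbours and
   [|nbs x| - 2] otherwise: at least half of them, or a third if it has three
   neighbours, but then the neighbours of [x] have degree at least 61. *)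
pose w x y := nb x y * (3 - (#|nbs x| == 3)).
(* Weights are in sixths of an edge. Equality holds at [x] with two, three or four neighbours. *)
have hX : 6 * (\sum_(x in X) minn 2 #|nbs x|.-1) + \sum_(x in X) \sum_(y in Y) w x y <=
          6 * (\sum_(x in X) \sum_(y in Y) nb x y).
  rewrite !big_distrr /= -big_split /=; apply: leq_sum => x xX.
  rewrite -big_distrl /=.
  have dx : \sum_(y in Y) nb x y = #|nbs x|.
    rewrite nbs_sum [S in _ = S + _]big1 ?add0n // => z zX.
    by apply/eqP; rewrite eqb0; apply/negP => /(nb_X xX); move: zX; rewrite !inE; lia.
  rewrite dx; have : 2 <= #|nbs x| by apply: nbs_ge2; move: xX; rewrite inE => /andP[].
  by case: eqP => [-> //|]; lia.
(* Normally [y] has at least 12 neighbours, as 3 * 12 >= 35, each worth 3. Next to some [x] with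
   three neighbours, so of degree at most 9, [y] has degree at least 61 and at least 21 neighbours,
   each worth at least 2. *)
have hY : 36 * #|Y| <= \sum_(x in X) \sum_(y in Y) w x y + 3 * (\sum_(y in Y) \sum_(z in Y) nb y z).
  rewrite exchange_big big_distrr /= -big_split /= mulnC -sum_nat_const.
  apply: leq_sum => y yY.
  have ny := nbs_sum y; have le3 := star_le_nbs y.
  have [/exists_inP[x xX /andP[xy /eqP n3]]|none] :=
    boolP [exists x in X, nb x y && (#|nbs x| == 3)].
    have : 2 * \sum_(x in X) nb y x <= \sum_(x in X) w x y.
      rewrite big_distrr; apply: leq_sum => z _; rewrite /w nb_sym /=.
      by case: (nb z y) => //; case: (_ == 3).
    have := star_le_nbs x; have := nb_sum xy; have := nb_star xy; lia.
  have -> : \sum_(x in X) w x y = 3 * \sum_(x in X) nb y x.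
    rewrite big_distrr; apply: eq_bigr => z zX; rewrite /w nb_sym /=.
    move: none; rewrite negb_exists_in => /forall_inP /(_ z zX); rewrite nb_sym.
    by case: (nb y z) => //= /negbTE ->.
  by move: yY; rewrite inE; lia.
lia.
Qed.

Lemma low_multiplicity_KP : U != set0 -> KP_in e U D.
Proof.
case/set0Pn => t tU.
have YN0 : Y != set0.
  have [|y xy _] := @nb_other_end (ends t).1 t; first by rewrite !inE tU /inc eqxx.
  have := nb_sum xy; have [xY|xY] := boolP ((ends t).1 \in Y).
    by move=> _; apply/set0Pn; exists (ends t).1.
  move=> sum; apply/set0Pn; exists y; move: xY; rewrite !inE; lia.
have Y2 v : v \in Y -> 2 <= #|nbs v|.
  by rewrite inE => vY; apply: nbs_ge2; apply: leq_trans vY.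
have demY : \sum_(y in Y) minn 2 #|nbs y|.-1 <= 2 * #|Y|.
  by rewrite mulnC -sum_nat_const; apply: leq_sum => y _; apply: geq_minl.
have count := weighted_count.
have [le|lt] := leqP (\sum_(x in X) minn 2 #|nbs x|.-1 + \sum_(y in Y) minn 2 #|nbs y|.-1)
                     (\sum_(x in X) \sum_(y in Y) nb x y).
  apply: (@dense_bipartite_KP (mem X) (X :|: Y)
            [set p : V * V | [&& p.1 \in X, p.2 \in Y & nb p.1 p.2]]).
  - by apply: contraNneq YN0 => XY0; rewrite -subset0 -XY0 subsetUr.
  - by move=> v /setUP[|/Y2//]; rewrite inE => /andP[v0 _]; apply: nbs_ge2.
  - move=> p; rewrite inE => /and3P[/= -> p2 ->]; rewrite andbT /=.
    by apply/negP => p2X; move/pred0P/(_ p.2): disjoint_XY; rewrite /= p2X p2.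
  rewrite sum_XY; apply: leq_trans le _; rewrite -card_pairs; apply: subset_leq_card.
  by apply/subsetP => p; rewrite !in_set => /and3P[-> -> ->]; rewrite orbT.
(* The X-Y edges number less than the demand of [X] plus [2 * #|Y|], so by [count] the double sum
   over [Y] exceeds [8 * #|Y|] and the cut has more than [2 * #|Y|] edges. *)
have [P sPY cut] := half_cut Y nb_sym nb_irr.
apply: (@dense_bipartite_KP (mem P) Y
          [set p : V * V | [&& p.1 \in P, p.2 \in Y :\: P & nb p.1 p.2]]) => //.
  by move=> p; rewrite !in_set => /and3P[/= -> /andP[-> _] ->].
apply: (@leq_trans (\sum_(u in P) \sum_(v in Y :\: P) nb u v)).
  by move: demY lt count cut; lia.
rewrite -card_pairs; apply: subset_leq_card; apply/subsetP => p.
move=> pA; apply/setIdP; split=> //; move: pA.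
by rewrite inE => /and3P[/(subsetP sPY) -> /setDP[-> _] _].
Qed.

End LowMultiplicity.
End Simple.

Theorem line_graph_KP : 69 <= D -> U != set0 -> KP_in e U D.
Proof.
move=> D69 U0.
have [/exists_inP[t tU low]|nlow] := boolP [exists t in U, deg e U t + 2 <= D].
  exact: low_degree_KP low.
have degD1 t : t \in U -> D <= (deg e U t).+1.
  move=> tU; move: nlow; rewrite negb_exists_in => /forall_inP /(_ t tU); lia.
have [/existsP[x /existsP[y /andP[xy mul4]]]|nmul] :=
  boolP [exists x, [exists y, (x != y) && (4 <= #|star x :&: star y|)]].
  exact: high_multiplicity_KP mul4.
apply: low_multiplicity_KP => // x y xy.
move: nmul; rewrite negb_exists => /forallP /(_ x); rewrite negb_exists => /forallP /(_ y).
by rewrite xy /= -ltnNge.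
Qed.

End LineGraph.

(** * Painting line graphs and the two conclusions *)

Lemma line_graph_KP_in (T : finType) (e : rel T) (U : {set T}) (D : nat) :
    simple_graph e -> is_line_graph e ->
    (forall v, v \in U -> deg e U v <= D) ->
    (forall K : {set T}, K \subset U -> clique e K -> #|K| < D) ->
    69 <= D -> U != set0 ->
  KP_in e U D.
Proof.
move=> [esym eirr] [V [ends [ends_neq e_ends]]] degD cliqueD.
exact: (line_graph_KP esym eirr ends_neq e_ends degD cliqueD).
Qed.

Lemma clique_le_omega (T : finType) (e : rel T) (K : {set T}) : clique e K -> #|K| <= omega e.
Proof. by move=> cK; apply: (@leq_bigmax_cond _ (clique e) (fun S : {set T} => #|S|)). Qed.

Lemma deg_sub_Delta (T : finType) (e : rel T) (U : {set T}) v : deg e U v <= Delta e.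
Proof.
apply: leq_trans (@leq_bigmax _ (degG e) v); apply/subset_leq_card/subsetP => u.
by rewrite !inE => /andP[_ ->].
Qed.

Lemma line_graph_paintable (T : finType) (e : rel T) (k : nat) (U : {set T}) :
    simple_graph e -> is_line_graph e -> 68 <= k -> omega e <= k -> Delta e <= k.+1 ->
  paintable e U (fun _ => k).
Proof.
move=> sg lg k68 wk Dk; have [esym eirr] := sg.
have [n le_n] := ubnP #|U|; elim: n U le_n => // n IHn U le_n.
have [->|U0] := eqVneq U set0.
  constructor=> [v|M]; first by rewrite inE.
  by rewrite subset0 => /eqP ->; rewrite eqxx.
have [||||S [sSU S0 [a [aS ae af kp]]]] := @line_graph_KP_in _ e U k.+1 sg lg.
- by move=> v _; apply: leq_trans (deg_sub_Delta _ _ _) Dk.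
- by move=> K _ /clique_le_omega cK; rewrite ltnS (leq_trans cK).
- by [].
- by [].
have -> : U = (U :\: S) :|: S by rewrite -{1}(setID U S) (setIidPr sSU) setUC.
apply: (@paintable_kernel_extend _ e (fun u v => 0 < a u v) S) => //.
- by move=> u v uS vS /(ae u v uS vS); rewrite addn_gt0.
- by rewrite -setI_eq0; apply/eqP/setP => x; rewrite !inE; case: (x \in S); rewrite ?andbF.
- apply: IHn; rewrite -ltnS; apply: leq_trans le_n; rewrite ltnS.
  by have := cardsID S U; rewrite (setIidPr sSU); move: S0; rewrite -card_gt0; lia.
move=> v vS; have vU := subsetP sSU v vS.
have le_a : #|[set u in S | 0 < a v u]| <= \sum_u a v u.
  rewrite -sum1dep_card big_mkcond /=; apply: leq_sum => u _.
  by case: (u \in S) => //=; case: (a v u).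
have degU : deg e U v = deg e S v + deg e (U :\: S) v.
  rewrite /deg -(cardsID S [set u in U | e v u]); congr (_ + _); apply: eq_card => u.
    rewrite !inE; case uS: (u \in S); last by rewrite andbF.
    by rewrite (subsetP sSU u uS) andbT.
  by rewrite !inE andbA.
(* The outdegree is below d_S - 1 + (k + 1) - d_U, and v has d_U - d_S neighbours outside S, so the
   two together stay below k. *)
have := af v vS; have := leq_trans (deg_sub_Delta e U v) Dk; lia.
Qed.

Theorem mainTheorem16 :
  (forall (T : finType) (e : rel T),
     simple_graph e -> is_line_graph e -> BK_free e ->
     omega e < Delta e -> Delta e < 69) /\
  (forall (T : finType) (e : rel T),
     simple_graph e -> is_line_graph e -> 69 <= Delta e ->
     chiOL_le e (maxn (omega e) (Delta e).-1)).
Proof.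
split=> T e sg lg.
  move=> [_ bk] wD; rewrite ltnNge; apply/negP => D69.
  have [||||S [_ S0 kp]] := @line_graph_KP_in _ e setT (Delta e) sg lg.
  - by move=> v _; apply: deg_sub_Delta.
  - by move=> K _ /clique_le_omega cK; apply: leq_ltn_trans wD.
  - by [].
  (* The maximum over an empty vertex type is 0, so [69 <= Delta e] yields a vertex. *)
  - have /existsP[v _] : [exists v : T, true].
      apply: contraLR D69; rewrite negb_exists => /forallP noT.
      by rewrite /Delta big1 // => v; have := noT v.
    by apply/set0Pn; exists v.
  by have [_ /(_ kp)] := bk S S0.
move=> D69; exists (maxn (omega e) (Delta e).-1); split; first by lia.
by apply: line_graph_paintable => //; lia.
Qed.
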